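(* Let $\Omega$ be any infinite set and let $\Sigma$ be a non-empty finite subset of $\Omega$. Then the setwise stabiliser $\operatorname{Sym}(\Omega)_{\{\Sigma\}}$ of $\Sigma$ in $\operatorname{Sym}(\Omega)$ is a maximal subsemigroup of $\operatorname{Sym}(\Omega)$.
   Context: $\operatorname{Sym}(\Omega)$ is the symmetric group on $\Omega$, and $\operatorname{Sym}(\Omega)_{\{\Sigma\}}=\{f\in\operatorname{Sym}(\Omega):\Sigma f=\Sigma\}$. A subsemigroup $T$ of a semigroup (or group) $S$ is a maximal subsemigroup if $T\neq S$ and the subsemigroup generated by $T$ and $s$ equals $S$ for all $s\in S\setminus T$ (generation is as a semigroup, without taking inverses). *)

(* Defs.v *)
From HB Require Import structures.
From mathcomp Require Import all_boot.
From mathcomp Require Import boolp classical_sets functions cardinality.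

Set Implicit Arguments.
Unset Strict Implicit.
Unset Printing Implicit Defensive.

Local Open Scope classical_set_scope.
Local Open Scope group_scope.

Section Semigroups.
Variable S : semigroupType.

Definition subsemigroup (T : set S) : Prop :=
  forall x y, T x -> T y -> T (x * y).

Definition generated_subsemigroup (A : set S) : set S :=
  smallest subsemigroup A.

Definition maximal_subsemigroup (T : set S) : Prop :=
  [/\ subsemigroup T,
      T <> [set: S] &
      forall s : S, ~ T s -> generated_subsemigroup (T `|` [set s]) = [set: S]].

End Semigroups.

Record Sym (Omega : Type) := MkSym {
  sym_fun :> Omega -> Omega;
  sym_bij : bijective sym_fun
}.

Section SymGroup.
Variable Omega : Type.

HB.instance Definition _ := gen_eqMixin (Sym Omega).
HB.instance Definition _ := gen_choiceMixin (Sym Omega).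

Implicit Types f g h : Sym Omega.

Lemma sym_ext f g : (forall x, f x = g x) -> f = g.
Proof.
case: f g => [f fbij] [g gbij] /= /funext fg; case: _ / fg in gbij *.
by rewrite (Prop_irrelevance fbij gbij).
Qed.

Definition sym_one : Sym Omega := MkSym (Bijective (frefl id) (frefl id)).

(* Permutations act on the right, as for finite [perm]: (f * g) x = g (f x). *)
Definition sym_mul f g : Sym Omega := MkSym (bij_comp (sym_bij g) (sym_bij f)).

Lemma sym_inv_ex f : {g : Sym Omega | cancel f g /\ cancel g f}.
Proof.
apply: cid; have [g fK gK] := sym_bij f.
by exists (MkSym (Bijective gK fK)).
Qed.

Definition sym_inv f : Sym Omega := projT1 (sym_inv_ex f).

Lemma sym_mulA : associative sym_mul.
Proof. by move=> f g h; apply: sym_ext. Qed.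

Lemma sym_mul1f : left_id sym_one sym_mul.
Proof. by move=> f; apply: sym_ext. Qed.

Lemma sym_mulf1 : right_id sym_one sym_mul.
Proof. by move=> f; apply: sym_ext. Qed.

Lemma sym_mulVf : left_inverse sym_one sym_inv sym_mul.
Proof.
by move=> f; apply: sym_ext => x /=; case: (projT2 (sym_inv_ex f)) => _; apply.
Qed.

Lemma sym_mulfV : right_inverse sym_one sym_inv sym_mul.
Proof.
by move=> f; apply: sym_ext => x /=; case: (projT2 (sym_inv_ex f)) => + _; apply.
Qed.

HB.instance Definition _ := isGroup.Build (Sym Omega)
  sym_mulA sym_mul1f sym_mulf1 sym_mulVf sym_mulfV.

Lemma symM f g x : (f * g) x = g (f x).
Proof. by []. Qed.

Lemma sym1 x : (1 : Sym Omega) x = x.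
Proof. by []. Qed.

Definition setwise_stabiliser (Sigma : set Omega) : set (Sym Omega) :=
  [set f | f @` Sigma = Sigma].

End SymGroup.

(* Main.v *)
Require Import Defs.
From mathcomp Require Import all_boot.
From mathcomp Require Import boolp classical_sets functions cardinality.
Local Open Scope classical_set_scope.

(** Write G for the stabiliser of Sigma, let s be a permutation outside G, and
    let U be the semigroup generated by G and s.

    The first point is that U contains the inverse of s, although it is only
    generated as a semigroup: the double coset G s G is closed under inverses.
    Indeed there is a g in G with s g s in G ([exists_stabiliser_sandwich]),
    whence s^-1 = g s (s g s)^-1 lies in U.  Such a g must carry the image of
    Sigma under s to its image under s^-1; both images are finite and meet
    Sigma in equally many points, so g can be assembled from finitely many
    transpositions of points on the same side of Sigma.

    Conjugating by s or by s^-1 a transposition of two points outside Sigma,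
    one of which is moved into Sigma and the other not, gives a transposition
    in U which exchanges a point of Sigma with a point outside
    ([crossing_swap]); the second of the two points exists because Omega is
    infinite.  Conjugating with transpositions from G shows that U contains
    every transposition.

    Finally, an arbitrary permutation f agrees on the finite set Sigma with a
    product p of transpositions ([swap_interpolation]), and f p^-1 fixes Sigma
    pointwise, so that f = (f p^-1) p lies in U. *)

(** * Transpositions of an arbitrary type *)

Section Swap.
Context {Omega : Type}.
Local Open Scope group_scope.
Implicit Types (a b x y : Omega) (f g s p : Sym Omega) (X Z Sigma : set Omega).

Definition swap_fun a b x : Omega :=
  if pselect (x = a) then b else if pselect (x = b) then a else x.

Lemma swap_funL a b : swap_fun a b a = b.
Proof. by rewrite /swap_fun; case: (pselect (a = a)). Qed.

Lemma swap_funR a b : swap_fun a b b = a.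
Proof.
by rewrite /swap_fun; case: (pselect (b = a)) => //= _; case: (pselect (b = b)).
Qed.

Lemma swap_funD a b x : x <> a -> x <> b -> swap_fun a b x = x.
Proof.
by rewrite /swap_fun; case: (pselect (x = a)) => //= _; case: (pselect (x = b)).
Qed.

Lemma swap_funK a b : involutive (swap_fun a b).
Proof.
move=> x; have [->|xa] := pselect (x = a); first by rewrite swap_funL swap_funR.
have [->|xb] := pselect (x = b); first by rewrite swap_funR swap_funL.
by rewrite !swap_funD.
Qed.

Definition swap a b : Sym Omega :=
  MkSym (Bijective (swap_funK a b) (swap_funK a b)).

Lemma swapL a b : swap a b a = b. Proof. exact: swap_funL. Qed.

Lemma swapR a b : swap a b b = a. Proof. exact: swap_funR. Qed.

Lemma swapD a b x : x <> a -> x <> b -> swap a b x = x.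
Proof. exact: swap_funD. Qed.

Lemma swapC a b : swap a b = swap b a.
Proof.
apply: sym_ext => x; have [->|xa] := pselect (x = a).
  by rewrite swapL swapR.
have [->|xb] := pselect (x = b); first by rewrite swapL swapR.
by rewrite !swapD.
Qed.

Lemma symK s : cancel s (s^-1)%g.
Proof. by move=> x; have := symM s (s^-1) x; rewrite mulgV sym1. Qed.

Lemma symVK s : cancel (s^-1)%g s.
Proof. by move=> x; have := symM (s^-1) s x; rewrite mulVg sym1. Qed.

Lemma sym_inj s : injective s.
Proof. exact: can_inj (symK s). Qed.

Lemma conj_swap s a b : s^-1 * swap a b * s = swap (s a) (s b).
Proof.
apply: sym_ext => x; rewrite !symM -{2}(symVK s x); set y := s^-1 x.
have [->|ya] := pselect (y = a); first by rewrite !swapL.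
have [->|yb] := pselect (y = b); first by rewrite !swapR.
by rewrite !swapD // => /sym_inj.
Qed.

(** A finite part of a permutation is a product of transpositions: once p
    agrees with f on X, correcting it at a further point x by the transposition
    of p x and f x disturbs nothing on X, because f and p are injective.  The
    set Z confines the construction, and T records that only transpositions
    of points of Z have been multiplied. *)
Lemma swap_interpolation (T : set (Sym Omega)) Z X f :
  subsemigroup T -> T 1 -> (forall a b, Z a -> Z b -> T (swap a b)) ->
  finite_set X -> X `<=` Z -> (forall x, X x -> Z (f x)) ->
  exists p, [/\ T p, forall x, X x -> p x = f x & forall z, ~ Z z -> p z = z].
Proof.
move=> Tmul T1 Tswap /(@finite_seqP {classic Omega})[l ->].
elim: l => [|x l IH] XZ fXZ; first by exists 1.
have [y yl|y yl|p [Tp pf pZ]] := IH.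
- by apply: XZ; rewrite /= inE yl orbT.
- by apply: fXZ; rewrite /= inE yl orbT.
have Zx : Z x by apply: XZ; rewrite /= mem_head.
have Zfx : Z (f x) by apply: fXZ; rewrite /= mem_head.
have Zpx : Z (p x).
  apply: contrapT => nZ; have := pZ _ nZ => /sym_inj pxx.
  by apply: nZ; rewrite pxx.
exists (p * swap (p x) (f x)); split.
- by apply: Tmul => //; apply: Tswap.
- move=> y; rewrite symM => /predU1P[->|yl]; first exact: swapL.
  have [->|yx] := pselect (y = x); first exact: swapL.
  rewrite [p y]pf // swapD // => [fypx|/sym_inj//].
  by apply: yx; apply: (@sym_inj p); rewrite pf.
- move=> z nZz; rewrite symM (pZ z) // swapD // => zE; by apply: nZz; rewrite zE.
Qed.

End Swap.

(** * The setwise stabiliser *)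

Section Stabiliser.
Context {Omega : Type} (Sigma : set Omega).
Local Open Scope group_scope.
Implicit Types (a b x y : Omega) (f g s p : Sym Omega).
Local Notation G := (setwise_stabiliser Sigma).

Lemma setwise_stabiliserP f : G f <-> forall x, Sigma (f x) <-> Sigma x.
Proof.
split=> [Gf x|fS].
  have GfE : f @` Sigma = Sigma := Gf.
  split=> [Sfx|Sx]; last by rewrite -GfE; exists x.
  by have [y Sy /(sym_inj f) <-] : (f @` Sigma) (f x) by rewrite GfE.
apply/seteqP; split=> [_ [x Sx <-]|x Sx]; first exact/fS.
by exists (f^-1 x); rewrite ?symVK //; apply/fS; rewrite symVK.
Qed.

Lemma setwise_stabiliserM : subsemigroup G.
Proof.
move=> f g /setwise_stabiliserP Gf /setwise_stabiliserP Gg.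
apply/setwise_stabiliserP => x; rewrite symM; exact: iff_trans (Gg _) (Gf _).
Qed.

Lemma setwise_stabiliser1 : G 1.
Proof. exact/setwise_stabiliserP. Qed.

Lemma setwise_stabiliserV f : G f -> G (f^-1).
Proof.
move=> /setwise_stabiliserP Gf; apply/setwise_stabiliserP => x.
by rewrite -{2}(symVK f x) Gf.
Qed.

Lemma setwise_stabiliser_swap a b : (Sigma a <-> Sigma b) -> G (swap a b).
Proof.
move=> ab; apply/setwise_stabiliserP => x.
have [->|xa] := pselect (x = a); first by rewrite swapL ab.
have [->|xb] := pselect (x = b); first by rewrite swapR ab.
by rewrite swapD.
Qed.

Lemma swap_notin_setwise_stabiliser a b :
  Sigma a -> ~ Sigma b -> ~ G (swap a b).
Proof.
by move=> Sa nSb /setwise_stabiliserP /(_ a); rewrite swapL => -[_ /(_ Sa)].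
Qed.

Lemma eq_setwise_stabiliser f g :
  (forall x, Sigma x -> f x = g x) -> G g -> G f.
Proof.
move=> fg Gg; apply: etrans Gg.
by apply/seteqP; split=> _ [x Sx <-]; exists x; rewrite ?fg.
Qed.

(** Let p in G agree with s on the points of Sigma which s keeps in Sigma.
    The permutation f = s^-1 p s^-1 satisfies s f s = p, but need not lie in
    G.  Only its values on the image of Sigma under s matter, however, and the
    choice of p ensures that a point of this finite set lies in Sigma if and
    only if its image under f does.  So the restriction of f to this set
    extends to an element of G, built separately inside and outside Sigma. *)
Lemma exists_stabiliser_sandwich s :
  finite_set Sigma -> exists g, G g /\ G (s * g * s).
Proof.
move=> finS.
have swapI a b : Sigma a -> Sigma b -> G (swap a b).
  by move=> Sa Sb; apply: setwise_stabiliser_swap.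
have swapO a b : (~` Sigma) a -> (~` Sigma) b -> G (swap a b).
  by move=> nSa nSb; apply: setwise_stabiliser_swap; split.
have finI X Y : finite_set X -> finite_set (X `&` Y : set Omega).
  by apply: sub_finite_set; apply: subIsetl.
have [|x []//|x []//|p [Gp ps _]] := swap_interpolation G Sigma
  (Sigma `&` [set x | Sigma (s x)]) s
  setwise_stabiliserM setwise_stabiliser1 swapI.
  exact: finI.
have pS := (setwise_stabiliserP p).1 Gp.
pose f := s^-1 * p * s^-1.
have fE y : f (s y) = s^-1 (p y) by rewrite /f !symM symK.
have [|x []//| |g1 [Gg1 g1f g1id]] := swap_interpolation G Sigma
  (s @` Sigma `&` Sigma) f setwise_stabiliserM setwise_stabiliser1 swapI.
- exact/finI/finite_image.
- by move=> _ [[y Sy <-] Ssy]; rewrite fE ps // symK.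
have [|x []//| |g2 [Gg2 g2f g2id]] := swap_interpolation G (~` Sigma)
  (s @` Sigma `&` ~` Sigma) f setwise_stabiliserM setwise_stabiliser1 swapO.
- exact/finI/finite_image.
- (* If z = f (s y) were in Sigma, then p z = s z = p y would force z = y. *)
  move=> _ [[y Sy <-] nSsy]; rewrite fE => Sz.
  have pz : p (s^-1 (p y)) = p y.
    by rewrite ps ?symVK //; split; rewrite //= symVK pS.
  apply: nSsy; rewrite -(sym_inj p _ _ pz) symVK; exact/pS.
exists (g1 * g2); split; first exact: setwise_stabiliserM.
apply: (eq_setwise_stabiliser _ p) => // y Sy; rewrite !symM.
have [Ssy|nSsy] := pselect (Sigma (s y)).
  rewrite g1f; last by split => //; exists y.
  by rewrite fE ps // symK g2id ?ps //; apply.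
rewrite g1id // g2f; last by split => //; exists y.
by rewrite fE symVK.
Qed.

(** * Semigroups containing the stabiliser *)

Section Overgroup.
Context (U : set (Sym Omega)).
Hypotheses (UM : subsemigroup U) (GU : G `<=` U).
Hypothesis infO : infinite_set [set: Omega].
Hypothesis finS : finite_set Sigma.

Lemma subsemigroup_inv s : U s -> U (s^-1).
Proof.
move=> Us; have [g [Gg Gw]] := exists_stabiliser_sandwich s finS.
have -> : s^-1 = g * s * (s * g * s)^-1.
  by rewrite -[LHS](mulgK (s * g * s)) -!mulgA mulKg.
apply: UM; first by apply: UM => //; apply: GU.
exact/GU/setwise_stabiliserV.
Qed.

Lemma crossing_swap s x : U s -> ~ Sigma x -> Sigma (s x) ->
  exists a b, [/\ Sigma a, ~ Sigma b & U (swap a b)].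
Proof.
move=> Us nSx Ssx.
(* A point y outside Sigma such that s y is outside Sigma as well. *)
have [y [_ yP]] : [set: Omega] `\` (Sigma `|` (s^-1)%g @` Sigma) !=set0.
  apply/infinite_setN0/infinite_setD => //.
  by rewrite finite_setU; split => //; apply: finite_image.
have nSy : ~ Sigma y by move=> Sy; apply: yP; left.
exists (s x), (s y); split=> //.
  by move=> Ssy; apply: yP; right; exists (s y); rewrite ?symK.
rewrite -conj_swap; apply: (UM _ _ _ Us); apply: UM; first exact: subsemigroup_inv.
by apply/GU/setwise_stabiliser_swap; split.
Qed.

Lemma all_swaps a b : Sigma a -> ~ Sigma b -> U (swap a b) ->
  forall c d, U (swap c d).
Proof.
move=> Sa nSb Uab.
have Uconj g c d : G g -> U (swap c d) -> U (swap (g c) (g d)).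
  move=> Gg Ucd; rewrite -conj_swap.
  by apply: UM (GU _ Gg); apply: UM => //; apply/GU/setwise_stabiliserV.
have Uio c d : Sigma c -> ~ Sigma d -> U (swap c d).
  move=> Sc nSd; have Uad : U (swap a d).
    have Gbd : G (swap b d) by apply: setwise_stabiliser_swap; split.
    have := Uconj _ _ _ Gbd Uab; rewrite swapL swapD //.
      by move=> ab; rewrite -ab in nSb.
    by move=> ad; rewrite -ad in nSd.
  have Gac : G (swap a c) by apply: setwise_stabiliser_swap; split.
  have := Uconj _ _ _ Gac Uad; rewrite swapL swapD //.
    by move=> da; rewrite da in nSd.
  by move=> dc; rewrite dc in nSd.
have UG c d : (Sigma c <-> Sigma d) -> U (swap c d).
  by move=> cd; apply/GU/setwise_stabiliser_swap.
move=> c d; have [Sc|nSc] := pselect (Sigma c); have [Sd|nSd] := pselect (Sigma d).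
- by apply: UG.
- exact: Uio.
- by rewrite swapC; apply: Uio.
- by apply: UG; split.
Qed.

(** Only the values of a permutation f on the finite set Sigma matter: a
    product p of transpositions agrees with f there, and then f p^-1 lies in
    G. *)
Lemma overgroup_full : (forall c d, U (swap c d)) -> U = [set: Sym Omega].
Proof.
move=> Uswap; apply/seteqP; split=> // f _.
have [||p [Up pf _]] := swap_interpolation U setT Sigma f UM
  (GU _ setwise_stabiliser1) (fun c d _ _ => Uswap c d) finS => //.
rewrite -(mulgVK p f); apply: UM => //; apply: GU.
apply: (eq_setwise_stabiliser _ 1); last exact: setwise_stabiliser1.
by move=> x Sx; rewrite symM -pf // symK.
Qed.

End Overgroup.
End Stabiliser.

Theorem theorem10p1 (Omega : Type) (Sigma : set Omega) :
  infinite_set [set: Omega] ->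
  finite_set Sigma ->
  Sigma !=set0 ->
  maximal_subsemigroup (setwise_stabiliser Sigma).
Proof.
move=> infO finS [a Sa]; split.
- exact: setwise_stabiliserM.
- have [b [_ nSb]] := infinite_setN0 (infinite_setD infO finS).
  move=> GT; apply: (swap_notin_setwise_stabiliser Sigma a b Sa nSb).
  by rewrite GT.
move=> s nGs; set U := generated_subsemigroup _.
have UM : subsemigroup U.
  by move=> f g Uf Ug T [TM sT]; apply: (TM); [apply: Uf|apply: Ug].
have GU : setwise_stabiliser Sigma `<=` U.
  by move=> f Gf; apply: sub_gen_smallest; left.
have Us : U s by apply: sub_gen_smallest; right.
have [c [d [Sc nSd Ucd]]] :
    exists c d, [/\ Sigma c, ~ Sigma d & U (swap c d)].
  have [x sx] : exists x, ~ (Sigma (s x) <-> Sigma x).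
    by apply/existsNP => sS; apply/nGs/setwise_stabiliserP.
  (* Either s or its inverse moves some point from outside Sigma into it. *)
  have [Sx|nSx] := pselect (Sigma x).
    have nSsx : ~ Sigma (s x) by move=> Ssx; apply: sx; split.
    have Us' := subsemigroup_inv Sigma U UM GU finS s Us.
    apply: (crossing_swap Sigma U UM GU infO finS (s^-1)%g (s x)) => //.
    by rewrite symK.
  apply: (crossing_swap Sigma U UM GU infO finS s x) => //.
  by apply: contrapT => nSsx; apply: sx; split.
apply: (overgroup_full Sigma U UM GU finS).
exact: (all_swaps Sigma U UM GU c d).
Qed.
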